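(* There are five subsets $E_0, E_1, E_2, E_3, E_4$ of the free group $\mathbb{F}_2$ on two generators, each of which is invariantly measurable, such that there is no $\mu \in P(\mathbb{F}_2)$ satisfying $\mu(gE_i) = \mu(E_i)$ for all $g \in \mathbb{F}_2$ and all $i < 5$.
   Context: For a group $G$, $P(G)$ denotes the collection of all finitely additive probability measures defined on all subsets of $G$. A subset $E$ of $G$ is invariantly measurable if there is a $\mu \in P(G)$ such that $\mu(gE) = \mu(E)$ for all $g \in G$, where $gE = \{gx : x \in E\}$. *)

(* Defs.v *)
From HB Require Import structures.
From mathcomp Require Import all_boot all_order all_algebra.
From mathcomp Require Import all_classical all_reals.

Set Implicit Arguments.
Unset Strict Implicit.
Unset Printing Implicit Defensive.

Import Order.TTheory GRing.Theory Num.Theory.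

Local Open Scope group_scope.

Section FreeGroup.
Variable X : choiceType.

(* (x, false) stands for the generator x and (x, true) for its inverse. *)
Definition letter : Type := X * bool.

Definition linv (a : letter) : letter := (a.1, ~~ a.2).

Definition reduced (w : seq letter) : bool :=
  sorted (fun a b => b != linv a) w.

Record free_group := FreeGroup { word : seq letter; word_reduced : reduced word }.

HB.instance Definition _ := [isSub for word].
HB.instance Definition _ := [Choice of free_group by <:].

(* For reduced w, the reduced form of the word a :: w. *)
Definition push (a : letter) (w : seq letter) : seq letter :=
  if w is b :: w' then if b == linv a then w' else a :: w else [:: a].

Definition word_mul (u v : seq letter) : seq letter := foldr push v u.

Definition word_inv (w : seq letter) : seq letter := rev (map linv w).

Lemma linvK : involutive linv.
Proof. by case=> x b; rewrite /linv /= negbK. Qed.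

Lemma reduced_behead a w : reduced (a :: w) -> reduced w.
Proof. exact: path_sorted. Qed.

Lemma reduced_push a w : reduced w -> reduced (push a w).
Proof.
case: w => [|b w] //= red_w.
by case: eqP => [_|/eqP ba]; [exact: path_sorted red_w | rewrite /= ba].
Qed.

Lemma reduced_mul u v : reduced v -> reduced (word_mul u v).
Proof. by move=> red_v; elim: u => //= a u IHu; apply: reduced_push. Qed.

Lemma reduced_inv w : reduced w -> reduced (word_inv w).
Proof.
rewrite /reduced /word_inv rev_sorted sorted_map; apply: sub_sorted => a b /=.
by rewrite linvK eq_sym.
Qed.

Lemma push_cons a w : reduced (a :: w) -> push a w = a :: w.
Proof. by case: w => [|b w] //= /andP[/negPf->]. Qed.

Lemma pushK a w : reduced w -> push (linv a) (push a w) = w.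
Proof.
case: w => [|b w] /=; first by rewrite linvK eqxx.
case: eqP => [-> red_w|_ _]; last by rewrite /= linvK eqxx.
exact: push_cons.
Qed.

Lemma word_mul_push a u v : reduced u -> reduced v ->
  word_mul (push a u) v = push a (word_mul u v).
Proof.
case: u => [|b u] //= red_u red_v.
case: eqP => [->|//].
by have := @pushK (linv a) _ (reduced_mul u red_v); rewrite linvK => ->.
Qed.

Lemma word_mulA u v w : reduced u -> reduced v -> reduced w ->
  word_mul u (word_mul v w) = word_mul (word_mul u v) w.
Proof.
move=> + red_v red_w; elim: u => //= a u IHu red_u.
rewrite IHu; last exact: reduced_behead red_u.
by rewrite word_mul_push // reduced_mul.
Qed.

Lemma word_mulw0 w : reduced w -> word_mul w [::] = w.
Proof.
elim: w => //= a w IHw red_w.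
by rewrite IHw ?push_cons //; apply: reduced_behead red_w.
Qed.

Lemma word_mulVw w : word_mul (word_inv w) w = [::].
Proof.
rewrite /word_mul /word_inv; elim: w => //= a w IHw.
by rewrite rev_cons foldr_rcons /= linvK eqxx.
Qed.

Lemma word_invK : involutive word_inv.
Proof. by move=> w; rewrite /word_inv map_rev revK mapK //; apply: linvK. Qed.

Definition fg_one : free_group := @FreeGroup [::] isT.
Definition fg_mul (u v : free_group) : free_group :=
  FreeGroup (reduced_mul (word u) (word_reduced v)).
Definition fg_inv (u : free_group) : free_group :=
  FreeGroup (reduced_inv (word_reduced u)).

Lemma fg_mulA : associative fg_mul.
Proof.
by move=> u v w; apply/val_inj/word_mulA; apply: word_reduced.
Qed.

Lemma fg_mul1g : left_id fg_one fg_mul.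
Proof. by move=> u; apply/val_inj. Qed.

Lemma fg_mulg1 : right_id fg_one fg_mul.
Proof. by move=> u; apply/val_inj/word_mulw0/word_reduced. Qed.

Lemma fg_mulVg : left_inverse fg_one fg_inv fg_mul.
Proof. by move=> u; apply/val_inj/word_mulVw. Qed.

Lemma fg_mulgV : right_inverse fg_one fg_inv fg_mul.
Proof.
move=> u; apply/val_inj => /=.
by rewrite -{1}[word u]word_invK word_mulVw.
Qed.

HB.instance Definition _ :=
  isGroup.Build free_group fg_mulA fg_mul1g fg_mulg1 fg_mulVg fg_mulgV.

Definition fg_gen (x : X) : free_group := @FreeGroup [:: (x, false)] isT.

Lemma free_group_universal (H : groupType) (f : X -> H) :
  exists! phi : free_group -> H,
    {morph phi : u v / u * v} /\ forall x, phi (fg_gen x) = f x.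
Proof.
pose ev (a : letter) := if a.2 then (f a.1)^-1 else f a.1.
pose evw := foldr (fun a h => ev a * h) 1.
have evV a : ev (linv a) = (ev a)^-1.
  by case: a => x [] //=; rewrite /ev /= invgK.
have ev_push a w : evw (push a w) = ev a * evw w.
  case: w => [|b w] //=; case: eqP => [->|//].
  by rewrite evV mulgA mulgV mul1g.
have ev_mul u v : evw (word_mul u v) = evw u * evw v.
  by elim: u => /= [|a u IHu]; rewrite ?mul1g // ev_push IHu mulgA.
exists (fun u => evw (word u)); split.
  by split=> [u v|x]; [apply: ev_mul | rewrite /= /ev mulg1].
move=> phi [phiM phi_gen]; apply/funext => -[w red_w] /=.
have phi1 : phi 1 = 1 by apply: (mulgI (phi 1)); rewrite -phiM !mulg1.
have phiV u : phi u^-1 = (phi u)^-1.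
  apply: (mulgI (phi u)); rewrite -phiM !mulgV; exact: phi1.
elim: w red_w => [|a w IHw] red_w /=.
  by rewrite -phi1; congr phi; apply: val_inj.
have red_w' := reduced_behead red_w.
have -> : FreeGroup red_w = @FreeGroup [:: a] isT * FreeGroup red_w'.
  by apply: val_inj; rewrite /= push_cons.
rewrite phiM (IHw red_w'); congr (_ * _); case: a {red_w} => x [].
  rewrite /ev /= -phi_gen -phiV; congr phi; exact: val_inj.
by rewrite /ev /= -phi_gen; congr phi; apply: val_inj.
Qed.

End FreeGroup.

Notation F2 := (free_group bool).

Local Open Scope classical_set_scope.
Local Open Scope ring_scope.

(* Finite additivity is stated for two disjoint sets; together with
   mu setT = 1 this forces mu set0 = 0 and gives all finite unions. *)
Definition fin_add_prob (R : realType) (G : Type) : set (set G -> R) :=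
  [set mu | [/\ forall A, 0 <= mu A,
                mu setT = 1
              & forall A B, A `&` B = set0 -> mu (A `|` B) = mu A + mu B]].
Arguments fin_add_prob : clear implicits.

Definition ltranslate (G : groupType) (g : G) (E : set G) : set G :=
  [set (g * x)%g | x in E].

Definition invariant_on (R : realType) (G : groupType)
    (mu : set G -> R) (E : set G) : Prop :=
  forall g : G, mu (ltranslate g E) = mu E.

Definition invariantly_measurable (R : realType) (G : groupType)
    (E : set G) : Prop :=
  exists2 mu, fin_add_prob R G mu & invariant_on mu E.
Arguments invariantly_measurable R {G} E.

(* Main.v *)
Require Import Defs.
From mathcomp Require Import all_boot all_order all_algebra.
From mathcomp Require Import all_classical all_reals.
From mathcomp Require Import lra zify.

(** Let [F2] be free on [a] and [b], let [h : F2 -> Z] be the morphism with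
    [h a = 0] and [h b = 1], and let [W] be the set of reduced words whose first
    letter is [a] or [a^-1].  The sets [W `&` {h > 0}] and [W `&` {h <= 0}] are
    both invariantly measurable: a translate of the first one (resp. the second
    one) contains only finitely many of the [b^-n] (resp. [b^n]), so an
    ultrafilter limit of Dirac masses along that sequence gives measure [0] to
    all translates.  Yet no measure is invariant on both.  With [k = b a b^-1],
    one has [W `|` a W = F2] while [W], [k W], [k^2 W] are pairwise disjoint, and
    [a], [k] lie in [ker h], hence preserve [Y = {h > 0}].  If [mu] is invariant
    on [W `&` Y], then [3 mu(W `&` Y) <= mu Y <= 2 mu(W `&` Y)], so [mu Y = 0];
    likewise [mu {h <= 0} = 0], contradicting [mu F2 = 1].  Two sets are thus
    enough, and the remaining three are copies of the second. *)

Import Order.TTheory GRing.Theory Num.Theory.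

Section Measures.
Local Open Scope classical_set_scope.
Local Open Scope ring_scope.

Lemma mem_ltranslate (G : groupType) (g x : G) (E : set G) :
  ltranslate g E x <-> E (g^-1 * x)%g.
Proof.
split=> [[y Ey <-]|Ex]; first by rewrite mulKg.
by exists (g^-1 * x)%g; rewrite ?mulVKg.
Qed.

Lemma fin_add_prob_le (R : realType) (G : Type) (mu : set G -> R) (A B : set G) :
  fin_add_prob R G mu -> A `<=` B -> mu A <= mu B.
Proof.
move=> [mu_ge0 _ muD] AB; rewrite -(setDUK AB) muD ?lerDl //.
by rewrite setDIK.
Qed.


(** For an ultrafilter [U] refining [\oo], let [mu] be 1 on the sets that contain [s n] for
    [U]-almost every [n] and 0 on the others; every translate of [E] is then null. *)
Lemma avoiding_invariantly_measurable (R : realType) (G : groupType)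
  (s : nat -> G) (E : set G) :
  (forall g, \forall n \near \oo, ~ E (g * s n)%g) -> invariantly_measurable R E.
Proof.
move=> avoid; have [U [U_ultra sub_U]] := @ultraFilterLemma _ (\oo : set_system nat) _.
have meet A B : U A -> U B -> exists n, A n /\ B n.
  by move=> UA UB; apply: (@filter_ex _ U _ (A `&` B)); exact: filterI.
pose mu (A : set G) : R := (`[< U (s @^-1` A) >])%:R.
have mu_translate g : mu (ltranslate g E) = 0.
  rewrite /mu; case: asboolP => // UE; exfalso.
  have /sub_U UC := avoid g^-1%g.
  have [n [/= /mem_ltranslate En nEn]] := meet _ _ UE UC.
  exact: nEn.
have mu1 : mu E = 0.
  rewrite -(mu_translate 1%g); congr mu; apply/seteqP; split=> x.
    by move=> Ex; apply/mem_ltranslate; rewrite invg1 mul1g.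
  by move=> /mem_ltranslate; rewrite invg1 mul1g.
exists mu; last by move=> g; rewrite mu_translate mu1.
split=> [A||A B AB0].
- by rewrite ler0n.
- by rewrite /mu preimage_setT asboolT //; exact: filterT.
rewrite /mu; case: (asboolP (U (s @^-1` A))) => UA.
  rewrite [X in X%:R + _]/= asboolT; last by apply: filterS UA => n; left.
  rewrite asboolF ?addr0 // => UB.
  have [n ABn] := meet _ _ UA UB.
  suff: (set0 : set G) (s n) by [].
  by rewrite -AB0.
rewrite add0r; congr (_%:R); congr nat_of_bool; apply/asbool_equiv_eq; split; last first.
  by apply: filterS => n; right.
(* As [U] is ultra, it contains the complement of the preimage of [A], on which the preimage of the
   union shrinks to that of [B]. *)
move=> UAB; have [//|UC] := in_ultra_setVsetC (s @^-1` A) U_ultra.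
by apply: filterS (filterI UAB UC) => n [[]].
Qed.

Lemma paradoxical_null (R : realType) (G : groupType) (mu : set G -> R)
  (W Y : set G) (a k : G) :
  (forall x, Y (a^-1 * x)%g <-> Y x) -> (forall x, Y (k^-1 * x)%g <-> Y x) ->
  (forall x, W x \/ W (a^-1 * x)%g) ->
  (forall x, W x -> ~ W (k^-1 * x)%g) ->
  (forall x, W x -> ~ W (k^-1 * (k^-1 * x))%g) ->
  fin_add_prob R G mu -> invariant_on mu (W `&` Y) -> mu Y = 0.
Proof.
move=> Ya Yk cover disj1 disj2 mu_prob inv; have [mu_ge0 _ muD] := mu_prob.
set E := W `&` Y in inv.
have lower : mu Y <= 2 * mu E.
  apply: (@le_trans _ _ (mu (E `|` (ltranslate a E `\` E)))).
    apply: fin_add_prob_le => // x Yx; have [Ex|nEx] := pselect (E x); [by left|right].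
    split=> //; apply/mem_ltranslate; split; last exact/Ya.
    by have [Wx|//] := cover x; case: nEx.
  rewrite muD ?setDIK // mulr_natl mulr2n lerD2l -[leRHS](inv a).
  exact: fin_add_prob_le.
have upper : 3 * mu E <= mu Y.
  have -> : 3 * mu E = mu (E `|` (ltranslate k E `|` ltranslate (k * k)%g E)).
    rewrite !muD ?inv; first by lra.
      (* [kE] and [k^2 E] are the translates by [k] of [E] and [kE], so [disj1] applies at
         [k^-1 x]. *)
      apply/seteqP; split=> // x [] /mem_ltranslate[Wk _] /mem_ltranslate[].
      by rewrite invgM -mulgA => /(disj1 _ Wk).
    apply/seteqP; split=> // x [[Wx _] [] /mem_ltranslate[]].
      by move=> /(disj1 _ Wx).
    by rewrite invgM -mulgA => /(disj2 _ Wx).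
  apply: fin_add_prob_le => // x [[]//|[] /mem_ltranslate[_]]; first by move/Yk.
  by rewrite invgM -mulgA => /Yk/Yk.
by have := mu_ge0 Y; have := mu_ge0 E; lra.
Qed.

End Measures.

Section Height.
Local Open Scope ring_scope.

Definition letter_height (l : letter bool) : int :=
  if l.1 then 0 else if l.2 then -1 else 1.

Definition height (u : F2) : int := \sum_(l <- word u) letter_height l.

Lemma sum_letter_height_push l w :
  \sum_(m <- push l w) letter_height m =
  letter_height l + \sum_(m <- w) letter_height m.
Proof.
case: w => [|m w] /=; first by rewrite big_cons.
case: eqP => [->|_]; rewrite !big_cons //.
by case: l => [[] []]; rewrite /letter_height /= ?add0r ?addNKr ?addKr.
Qed.

Lemma heightM u v : height (u * v)%g = height u + height v.
Proof.
rewrite /height /=; elim: (word u) => /= [|l w IHw]; first by rewrite big_nil add0r.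
by rewrite sum_letter_height_push IHw big_cons addrA.
Qed.

Lemma heightX u n : height (u ^+ n)%g = height u *+ n.
Proof.
elim: n => [|n IHn]; first by rewrite expg0 /height big_nil.
by rewrite expgS mulrS heightM IHn.
Qed.

End Height.

Section Pieces.
Local Open Scope classical_set_scope.
Local Open Scope ring_scope.

Let a : F2 := fg_gen true.
Let b : F2 := fg_gen false.
Let k : F2 := (b * a * b^-1)%g.

Definition starts_with_a : set F2 :=
  [set u : F2 | if word u is l :: _ then l.1 else false].

(** The boolean lets one argument serve both halves: [true] is positive height, [false] is height at
    most 0. *)
Definition height_side (e : bool) : set F2 := [set u | (0 < height u) = e].

Definition piece (e : bool) : set F2 := starts_with_a `&` height_side e.

Lemma piece_measurable (R : realType) e : invariantly_measurable R (piece e).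
Proof.
(* Powers of [c] drive the height out of side [e]; once [n] exceeds [|height g|], the sign of the
   height of [g c^n] is that of [height c]. *)
pose c : F2 := if e then b^-1%g else b.
apply: (@avoiding_invariantly_measurable _ _ (fun n => (c ^+ n)%g)) => g.
exists `|height g|.+1%N => // n /= gn [_]; rewrite /height_side /= heightM heightX.
have -> : height c = if e then -1 else 1.
  by rewrite /c; case: (e); rewrite /height /= big_cons big_nil addr0.
by case: (e); lia.
Qed.

Lemma piece_invariant_null (R : realType) (mu : set F2 -> R) e :
  fin_add_prob R F2 mu -> invariant_on mu (piece e) -> mu (height_side e) = 0.
Proof.
apply: (@paradoxical_null _ _ _ _ _ a k).
- by move=> u; rewrite /height_side /= heightM {1}/height unlock add0r.
- by move=> u; rewrite /height_side /= heightM {1}/height unlock add0r.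
(* If [u] does not start with [a] or its inverse, nothing cancels in [a^-1 u]. If it does, nothing
   cancels between [b^-1] and [u], so [k^-1 u] and [k^-2 u] both start with [b]. *)
- case=> [[|[[] ?] w] red_w]; rewrite /starts_with_a /=; by [left|right].
- by case=> [[|[[] ?] w] red_w].
- by case=> [[|[[] ?] w] red_w].
Qed.

End Pieces.

Theorem theorem1p4 (R : realType) :
  exists E : 'I_5 -> set F2,
    (forall i : 'I_5, invariantly_measurable R (E i)) /\
    ~ exists mu : set F2 -> R,
        fin_add_prob R F2 mu /\
        forall (g : F2) (i : 'I_5), mu (ltranslate g (E i)) = mu (E i).
Proof.
exists (fun i => piece (i == ord0)); split=> [i|[mu [mu_prob inv]]].
  exact: piece_measurable.
have null e : mu (height_side e) = 0%R.
  apply: piece_invariant_null => // g.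
  by case: e; [exact: inv g ord0 | exact: inv g ord_max].
have [_ mu1 muD] := mu_prob.
have := oner_neq0 R; rewrite -mu1.
have -> : setT = (height_side true `|` height_side false)%classic.
  by apply/seteqP; split=> // u _; rewrite /height_side /=; case: ltP; [left|right].
rewrite muD ?null ?addr0 ?eqxx //.
by apply/seteqP; split=> // u []; rewrite /height_side /= => ->.
Qed.
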